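(* Let $\alpha>0$, $\epsilon>0$ and $C>0$. There is an $r_0>0$, depending only on $\alpha$, $\epsilon$ and $C$, such that the following holds. Let $(X,d,\mu)$ be a complete, geodesic metric measure space with $\mu$ a $C$-doubling measure, $\operatorname{diam} X=1$ and $\mu(X)=1$. If $E\subset X$ is a Borel set with $\mu(E)\geq\alpha$, then there is a ball $B$ of radius $r\in[r_0,1]$ such that $$E\cap B\neq\emptyset\quad\text{and}\quad \operatorname{sparse}(E,B)<\epsilon.$$
   Context: $B(x,r)=\{y\in X: d(x,y)\le r\}$ denotes the closed ball; balls are considered together with their center and radius, and all balls are closed. A metric measure space $(X,d,\mu)$ is a metric space with an (outer) measure $\mu$. A non-zero Borel regular measure $\mu$ is $C$-doubling if it assigns finite measure to every ball and $\mu(B(x,2r))\le C\mu(B(x,r))$ for every ball $B(x,r)\subset X$. $X$ is geodesic if for all $x,y\in X$ there is an isometric embedding $f:[0,d(x,y)]\to X$ with $f(0)=x$ and $f(d(x,y))=y$. For a set $E\subseteq X$ and a closed ball $B$ of radius $r$ with $E\cap B\neq\emptyset$, the sparsity is $$\operatorname{sparse}(E,B)=\frac{\sup\{\operatorname{dist}(x,E\cap B):x\in B\}}{r};$$ it is undefined if $E\cap B=\emptyset$. *)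

(* Defs.v *)
From HB Require Import structures.
From mathcomp Require Import all_boot all_order all_algebra.
From mathcomp Require Import all_classical all_reals all_analysis.

Set Implicit Arguments.
Unset Strict Implicit.
Unset Printing Implicit Defensive.

Import Order.TTheory GRing.Theory Num.Theory.

Local Open Scope classical_set_scope.
Local Open Scope ring_scope.

Section Metric.
Context {R : realType} {X : metricType R}.

(* Not the library's [closed_ball], which is the closure of the open ball. *)
Definition cball (x : X) (r : R) : set X := [set y | mdist x y <= r].

(* Extended-real supremum, so that an unbounded set has diameter [+oo]. *)
Definition diam (A : set X) : \bar R :=
  ereal_sup [set (mdist p.1 p.2)%:E | p in A `*` A].

(* Meaningful only for nonempty [A]: the library sets [inf set0 = 0]. *)
Definition dist_to (x : X) (A : set X) : R := inf [set mdist x y | y in A].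

(* Meaningful only when [E] meets the ball and [0 < r]; then the supremum is
   over a nonempty set of reals bounded by [2 * r]. *)
Definition sparse (E : set X) (x : X) (r : R) : R :=
  sup [set dist_to y (E `&` cball x r) | y in cball x r] / r.

Definition borel (A : set X) : Prop := <<s @open X >> A.

End Metric.

Section Space.
Context {R : realType} (X : metricType R).

(* The axiom of the library's [completeType], which cannot be used here as it
   requires a pointed type. *)
Definition complete_space : Prop :=
  forall F : set_system X, ProperFilter F -> cauchy F -> exists l : X, F --> l.

Definition geodesic : Prop :=
  forall x y : X, exists f : R -> X,
    [/\ {in `[0, mdist x y] &, forall s t, mdist (f s) (f t) = `|s - t|},
        f 0 = x & f (mdist x y) = y].

End Space.

Section Measure.
Context {R : realType} {X : metricType R}.
Local Open Scope ereal_scope.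

Definition borel_regular (mu : {outer_measure set X -> \bar R}) : Prop :=
  (forall A, borel A -> mu.-caratheodory A) /\
  (forall A : set X, exists B, [/\ borel B, A `<=` B & mu B = mu A]).

Definition doubling (C : R) (mu : {outer_measure set X -> \bar R}) : Prop :=
  [/\ mu setT != 0,
      borel_regular mu,
      forall (x : X) (r : R), (0 < r)%R -> mu (cball x r) < +oo &
      forall (x : X) (r : R), (0 < r)%R ->
        mu (cball x (2 * r)) <= C%:E * mu (cball x r)].

End Measure.

(* Main.v *)
Require Import Defs.
From HB Require Import structures.
From mathcomp Require Import all_boot all_order all_algebra.
From mathcomp Require Import all_classical all_reals all_analysis.
From mathcomp Require Import lra.

Set Implicit Arguments.
Unset Strict Implicit.
Unset Printing Implicit Defensive.

Import Order.TTheory GRing.Theory Num.Theory.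

Local Open Scope classical_set_scope.
Local Open Scope ring_scope.

(** The measure of the neighbourhoods of [E] decays geometrically.  Write [N_t]
    for the open [t]-neighbourhood of [E], and suppose that every ball centred
    on [E], of radius between [r0] and [1], has sparsity at least [eps].

    Holes.  In such a ball [B(x,t)] some point is at distance of order [eps * t]
    from [E] inside the ball.  That point may sit near the boundary; pulling it
    towards [x] along a geodesic gives a ball of radius [eta * t] that lies
    inside [B(x,t)], so that it misses all of [E] and not only [E] inside
    [B(x,t)] ([sparse_hole]).  The concentric ball of half the radius lies in
    [N_t] and misses [N_(sigma * t)], where [sigma = eta / 2].

    Loss of mass.  Take a maximal subset of [E] with mutual distances greater
    than [2 * t]; it is finite because [X] is bounded and [mu] is doubling
    ([finite_net]).  The balls of radius [t] at its points are disjoint, hence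
    so are their holes, whereas the balls of radius [4 * t] cover [N_t].  By
    doubling the measure of the latter is at most [C ^+ k] times that of the
    holes, with [k] depending on [eps] only.  Therefore
    [mu N_t <= C ^+ k * (mu N_t - mu N_(sigma * t))] ([nbhd_loss]), which bounds
    [mu N_(sigma * t)] by [q * mu N_t] for a [q < 1] that depends on [C] and
    [eps] only.

    Iteration.  Starting from [mu N_1 <= 1], after [n] steps
    [mu E <= mu N_(sigma ^+ n) <= q ^+ n].  If [n] is chosen with
    [q ^+ n < alpha], this is absurd, so [r0 = sigma ^+ n] works. *)

(** * Powers *)

Lemma pow2_ge (R : realType) (a : R) : exists k, a <= 2 ^+ k.
Proof.
exists (Num.bound `|a|); apply: le_trans (ler_norm a) _.
rewrite ltW // (lt_le_trans (archi_boundP _)) ?normr_ge0 //.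
by rewrite -natrX ler_nat ltnW // ltn_expl.
Qed.

Lemma expr_small (R : realType) (q a : R) : 0 <= q < 1 -> 0 < a ->
  exists n, q ^+ n < a.
Proof.
move=> /andP[q0 q1] a0.
have q_lt1 : `|q| < 1 by rewrite ger0_norm.
have /cvgrPdist_lt/(_ a a0)[n _ /(_ n (leqnn n))] := cvg_expr q_lt1.
rewrite /= sub0r normrN ger0_norm ?exprn_ge0 // => ?; by exists n.
Qed.

(** * Neighbourhoods, separated families and holes *)

Section Metric.
Context {R : realType} {X : metricType R}.
Implicit Types (x y z e : X) (E : set X) (t r eta eps : R).

Definition nbhd E t : set X := [set y | exists2 e, E e & mdist e y < t].

(** The bound [2 * t], and not [t], makes the balls of radius [t] disjoint. *)
Definition separated t (s : seq X) : bool :=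
  pairwise (fun x y => 2 * t < mdist x y) s.

Lemma open_nbhd E t : open (nbhd E t).
Proof.
rewrite openE => y [e Ee ey]; rewrite /interior; apply/nbhs_ballP.
exists (t - mdist e y) => /=; first by rewrite subr_gt0.
move=> z; rewrite ballEmdist /= => yz; exists e => //.
by have := metric_triangle e y z; lra.
Qed.

Lemma open_setC_cball x r : open (~` cball x r).
Proof.
rewrite openE => y /= /negP; rewrite -ltNge => xy; rewrite /interior.
apply/nbhs_ballP; exists (mdist x y - r) => /=; first by rewrite subr_gt0.
move=> z; rewrite ballEmdist /= => yz; apply/negP; rewrite -ltNge.
by have := metric_triangle x z y; rewrite (metric_sym z); lra.
Qed.

Lemma nbhd_le E t t' : t <= t' -> nbhd E t `<=` nbhd E t'.
Proof. by move=> tt y [e Ee ey]; exists e => //; lra. Qed.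

Lemma sub_nbhd E t : 0 < t -> E `<=` nbhd E t.
Proof. by move=> t0 e Ee; exists e; rewrite ?mdistxx. Qed.

Lemma dist_to_le x E e : E e -> dist_to x E <= mdist x e.
Proof.
move=> Ee; apply: ge_inf; last by exists e.
by exists 0 => _ [y _ <-]; exact: mdist_ge0.
Qed.

(** Follow a geodesic from [x] to [z] and stop at distance [t - rho]; this is
    what keeps a ball of radius [rho] around the new point inside the ball of
    radius [t] around [x]. *)
Lemma geodesic_inner_point x z t rho : geodesic X ->
  0 <= rho <= t -> mdist x z <= t ->
  exists2 y, mdist x y <= t - rho & mdist y z <= rho.
Proof.
move=> geo rt xz; have [f [f_iso f0 fd]] := geo x z.
have d0 : 0 <= mdist x z := mdist_ge0 x z.
have [dle|dgt] := leP (mdist x z) (t - rho).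
  by exists z => //; rewrite mdistxx; lra.
exists (f (t - rho)).
  rewrite -{1}f0 f_iso ?in_itv /= ?lexx ?d0 //; last lra.
  by rewrite sub0r normrN ger0_norm; lra.
rewrite -{1}fd f_iso ?in_itv /= ?lexx ?d0 //; last lra.
by rewrite distrC ger0_norm; lra.
Qed.

(** The sparsity yields [z] in the ball with distance more than [2 * eta * t]
    to [E] within the ball.  Moving [z] inwards by [eta * t] halves this
    distance, but then any point of [E] closer than [eta * t] would lie in the
    ball, so the distance is now to the whole of [E]. *)
Lemma sparse_hole E x t eps eta : geodesic X ->
  0 < eta <= 1 -> 4 * eta <= eps -> 0 < t ->
  eps <= sparse E x t ->
  exists2 y, mdist x y <= t - eta * t & forall e, E e -> eta * t < mdist y e.
Proof.
move=> geo /andP[eta0 eta1] eta_eps t0.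
rewrite /sparse ler_pdivlMr // => sup_ge.
have et0 : 0 < eta * t by rewrite mulr_gt0.
have ett : eta * t <= t by rewrite ler_piMl // ltW.
have eeps : 4 * (eta * t) <= eps * t by rewrite mulrA ler_pM2r.
have [||_ [z xz <-] z_far] := @sup_gt R
  [set dist_to y (E `&` cball x t) | y in cball x t] (2 * (eta * t)).
- by exists (dist_to x (E `&` cball x t)), x => //; rewrite /cball /= mdistxx ltW.
- by lra.
have [|y xy yz] := geodesic_inner_point geo _ xz (rho := eta * t).
  by rewrite ltW.
have y_in : cball y (eta * t) `<=` cball x t.
  by move=> w; rewrite /cball /= => yw; have := metric_triangle x y w; lra.
exists y => // e Ee; rewrite ltNge; apply/negP => ye.
have := @dist_to_le z (E `&` cball x t) e (conj Ee (y_in e ye)).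
by have := metric_triangle z y e; rewrite (metric_sym z y); lra.
Qed.

End Metric.

(** * Measures of total mass one *)

Section Measure.
Context {R : realType} {X : metricType R} (mu : {outer_measure set X -> \bar R}).
Context (open_meas : forall U : set X, open U -> mu.-caratheodory U).
Context (mu_total : mu [set: X] = 1%:E).
Implicit Types (x y z e : X) (E A B : set X) (s : seq X) (t r eta : R).

(** Since the total mass is finite, real values may replace extended ones. *)
Let m A : R := fine (mu A).

Lemma fin_mu A : mu A \is a fin_num.
Proof.
rewrite ge0_fin_numE ?outer_measure_ge0 //.
apply: (@le_lt_trans _ _ (mu [set: X])); first exact: le_outer_measure.
by rewrite mu_total ltry.
Qed.

Lemma m_ge0 A : 0 <= m A.
Proof. by apply: fine_ge0; exact: outer_measure_ge0. Qed.

Lemma m_total : m [set: X] = 1.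
Proof. by rewrite /m mu_total. Qed.

Lemma le_m A B : A `<=` B -> m A <= m B.
Proof. by move=> AB; apply: fine_le; rewrite ?fin_mu //; exact: le_outer_measure. Qed.

Lemma m_cut A B : mu.-caratheodory A -> m B = m (B `&` A) + m (B `&` ~` A).
Proof. by move=> /(_ B) mB; rewrite /m mB fineD ?fin_mu. Qed.

Lemma cball_caratheodory x r : mu.-caratheodory (cball x r).
Proof.
rewrite -[cball x r]setCK; apply: caratheodory_measurable_setC.
exact/open_meas/open_setC_cball.
Qed.

Lemma m_bigU_le (F : X -> set X) s :
  m (\big[setU/set0]_(x <- s) F x) <= \sum_(x <- s) m (F x).
Proof.
elim: s => [|x s IH]; first by rewrite !big_nil /m outer_measure0.
rewrite !big_cons; apply: (@le_trans _ _ (m (F x) + m (\big[setU/set0]_(y <- s) F y))).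
  rewrite -fineD ?fin_mu //; apply: fine_le; rewrite ?fin_numD ?fin_mu //.
  exact: outer_measureU2.
by rewrite lerD2l.
Qed.

Lemma mem_bigU (F : X -> set X) s z :
  (\big[setU/set0]_(x <- s) F x) z <-> exists2 x, x \in s & F x z.
Proof.
elim: s => [|a s IH].
  by rewrite big_nil; split => // -[x]; rewrite in_nil.
rewrite big_cons; split=> [[Fz|/IH[x xs Fz]]|[x]].
- by exists a; rewrite ?mem_head.
- by exists x; rewrite // in_cons xs orbT.
- by rewrite in_cons => /predU1P[-> ?|xs Fz]; [left|right; apply/IH; exists x].
Qed.

(** Finite additivity for an outer measure: sets attached to a separated family
    of centres are disjoint, and they can be split off one at a time by the
    Caratheodory condition. *)
Lemma m_bigU_separated t (F : X -> set X) s : separated t s ->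
  (forall x, x \in s -> mu.-caratheodory (F x) /\ F x `<=` cball x t) ->
  m (\big[setU/set0]_(x <- s) F x) = \sum_(x <- s) m (F x).
Proof.
elim: s => [|a s IH]; first by rewrite !big_nil /m outer_measure0.
rewrite /separated pairwise_cons => /andP[/allP a_far sep] HF.
have HFs x : x \in s -> mu.-caratheodory (F x) /\ F x `<=` cball x t.
  by move=> xs; apply: HF; rewrite in_cons xs orbT.
have [aM a_sub] := HF a (mem_head a s).
rewrite !big_cons -(IH sep HFs) (m_cut (_ `|` _) aM) setIUl setIid.
have a_disj z : F a z -> ~ (\big[setU/set0]_(x <- s) F x) z.
  move=> /a_sub az /mem_bigU[x xs /(HFs x xs).2 xz].
  have := a_far x xs; have := metric_triangle a z x.
  by rewrite (metric_sym z); move: az xz; rewrite /cball /=; lra.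
congr (m _ + m _); apply/seteqP; split => z /=.
- by case=> // -[bz az]; case: (a_disj z).
- by move=> az; left.
- by case=> -[].
- by move=> bz; split; [right | move=> az; case: (a_disj z)].
Qed.

(** If no finite separated family of points of [E] is maximal, there is one of
    every cardinality; its disjoint balls, of measure at least [c] each, end up
    having total measure more than [1]. *)
Lemma finite_net E t c : 0 < c -> (forall x, c <= m (cball x t)) ->
  exists s, [/\ separated t s, forall x, x \in s -> E x &
                forall e, E e -> exists2 x, x \in s & mdist e x <= 2 * t].
Proof.
move=> c0 ball_ge; apply: contrapT => no_net.
have sep n : exists s, [/\ size s = n, separated t s & forall x, x \in s -> E x].
  elim: n => [|n [s [szs seps sE]]]; first by exists [::].
  apply: contrapT => no_ext; apply: no_net; exists s; split=> // e Ee.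
  apply: contrapT => e_far; apply: no_ext; exists (e :: s); split.
  - by rewrite /= szs.
  - rewrite /separated pairwise_cons; apply/andP; split => //.
    apply/allP => x xs; rewrite ltNge; apply/negP => ex.
    by apply: e_far; exists x.
  - by move=> x; rewrite in_cons => /predU1P[->|/sE].
have [s [szs seps _]] := sep (Num.bound c^-1).
suff : c * (Num.bound c^-1)%:R <= 1.
  rewrite -ler_pdivlMl // mulr1 leNgt archi_boundP // invr_ge0; exact: ltW.
rewrite -[leRHS]m_total.
apply: le_trans (le_m (@subsetT _ (\big[setU/set0]_(x <- s) cball x t))).
rewrite (@m_bigU_separated t) //; last first.
  by move=> x _; split => //; exact: cball_caratheodory.
by rewrite -szs mulr_natr -iter_addr_0 -(count_predT s) -big_const_seq ler_sum //.
Qed.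

(** * Doubling and the loss of mass *)

Section Doubling.
Context (C : R).
Context (C_gt0 : 0 < C).
Context (mu_doubling : forall x r, 0 < r -> m (cball x (2 * r)) <= C * m (cball x r)).

Lemma m_cball_iter k x r : 0 < r -> m (cball x (2 ^+ k * r)) <= C ^+ k * m (cball x r).
Proof.
move=> r0; elim: k => [|k IH]; first by rewrite !expr0 !mul1r.
rewrite exprS -mulrA (le_trans (mu_doubling _ _)) ?mulr_gt0 ?exprn_gt0 //.
by rewrite exprS -mulrA ler_pM2l.
Qed.

Context (diam_le1 : forall x y, mdist x y <= 1).

(** By the diameter bound a ball of radius [2 ^+ k * t >= 1] is the whole space;
    doubling transfers its mass to the ball of radius [t]. *)
Lemma m_cball_ge t : 0 < t -> exists2 c, 0 < c & forall x, c <= m (cball x t).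
Proof.
move=> t0; have [k k_ge] := pow2_ge t^-1; exists (C ^- k).
  by rewrite invr_gt0 exprn_gt0.
move=> x; rewrite -[_^-1]mulr1 ler_pdivrMl ?exprn_gt0 //.
apply: le_trans (m_cball_iter k x t0); rewrite -[leLHS]m_total; apply: le_m => y _.
by apply: le_trans (diam_le1 x y) _; rewrite -ler_pdivrMr // mul1r.
Qed.

(** The constant [10]: with [rho = eta / 2 * t] the radius of the trimmed hole,
    the ball of radius [4 * t] about a centre lies in the ball of radius [5 * t]
    about its hole, and [10 <= 2 ^+ k * eta] says that [5 * t <= 2 ^+ k * rho]. *)
Lemma nbhd_loss E t eta k : 0 < t -> 0 < eta <= 1 -> 10 <= 2 ^+ k * eta ->
  (forall x, E x -> exists2 y, mdist x y <= t - eta * t &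
                      forall e, E e -> eta * t < mdist y e) ->
  m (nbhd E t) <= C ^+ k * (m (nbhd E t) - m (nbhd E (eta / 2 * t))).
Proof.
move=> t0 /andP[eta0 eta1] k_ge holes.
pose rho := eta / 2 * t.
have rhoE : eta * t = 2 * rho by rewrite /rho; lra.
have rho0 : 0 < rho by rewrite !mulr_gt0.
have ett : eta * t <= t by rewrite ler_piMl // ltW.
have far_ge : 5 * t <= 2 ^+ k * rho.
  suff : 10 * t <= 2 ^+ k * eta * t by rewrite -mulrA rhoE; lra.
  by rewrite ler_pM2r.
have /choice[h hP] x : exists y, E x ->
    mdist x y <= t - eta * t /\ (forall e, E e -> eta * t < mdist y e).
  by have [/holes[y]|nEx] := pselect (E x); [exists y | exists x].
have [c c0 c_le] := m_cball_ge t0.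
have [s [sep sE s_net]] := finite_net E c0 c_le.
(* A point of the neighbourhood is within [t] of [E], hence within [3 * t] of a
   centre. *)
have cover : nbhd E t `<=` \big[setU/set0]_(x <- s) cball x (4 * t).
  move=> z [e Ee ez]; have [x xs ex] := s_net e Ee.
  apply/mem_bigU; exists x => //; rewrite /cball /=.
  by have := metric_triangle x e z; rewrite (metric_sym x e); lra.
have ball_le x : x \in s -> m (cball x (4 * t)) <= C ^+ k * m (cball (h x) rho).
  move=> /sE/hP[xh _]; apply: le_trans (m_cball_iter k (h x) rho0).
  apply: le_m => z; rewrite /cball /= => xz.
  by have := metric_triangle (h x) x z; rewrite (metric_sym (h x) x); lra.
apply: le_trans (le_m cover) _; apply: le_trans (m_bigU_le _ _) _.
apply: (@le_trans _ _ (\sum_(x <- s) C ^+ k * m (cball (h x) rho))).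
  by rewrite big_seq [leRHS]big_seq ler_sum.
rewrite -mulr_sumr ler_pM2l ?exprn_gt0 //.
rewrite -(@m_bigU_separated t (fun x => cball (h x) rho)) //; last first.
  move=> x /sE/hP[xh _]; split; first exact: cball_caratheodory.
  by move=> z; rewrite /cball /= => hz; have := metric_triangle x (h x) z; lra.
(* The smaller neighbourhood and the union of the trimmed holes are disjoint
   parts of [nbhd E t]. *)
rewrite -/rho lerBrDl (m_cut (nbhd E t) (open_meas (open_nbhd E rho))).
apply: lerD; apply: le_m => z.
  by move=> zE; split => //; apply: nbhd_le zE; lra.
move=> /mem_bigU[x xs]; rewrite /cball /= => hz; have [xh h_far] := hP x (sE x xs).
split; first by exists x; [exact: sE | have := metric_triangle x (h x) z; lra].
move=> [e Ee ez]; have := h_far e Ee.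
by have := metric_triangle (h x) z e; rewrite (metric_sym z e); lra.
Qed.

End Doubling.
End Measure.

(** * Geometric decay over the scales *)

Theorem corollary1p5 (R : realType) (alpha eps C : R)
    (alpha_gt0 : 0 < alpha) (eps_gt0 : 0 < eps) (C_gt0 : 0 < C) :
  exists2 r0 : R, 0 < r0 &
    forall (X : metricType R) (mu : {outer_measure set X -> \bar R}),
      complete_space X -> geodesic X -> doubling C mu ->
      diam [set: X] = 1%:E -> mu [set: X] = 1%:E ->
      forall E : set X, borel E -> (alpha%:E <= mu E)%E ->
        exists (x : X) (r : R),
          [/\ r0 <= r <= 1, E `&` cball x r !=set0 & sparse E x r < eps].
Proof.
(* The minimum keeps [eta <= 1], so that holes fit into their balls. *)
pose eta := Num.min 1 eps / 4.
have [eta0 eta1 eta_eps] : [/\ 0 < eta, eta <= 1 & 4 * eta <= eps].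
  have m0 : 0 < Num.min 1 eps by rewrite lt_min ltr01.
  have m1 : Num.min 1 eps <= 1 by rewrite ge_min lexx.
  have m2 : Num.min 1 eps <= eps by rewrite ge_min lexx orbT.
  by rewrite /eta; split; lra.
have [k k_ge] := pow2_ge (10 / eta).
have {}k_ge : 10 <= 2 ^+ k * eta by rewrite -ler_pdivrMr.
(* The summand [1] ensures [1 <= K], hence [0 <= q], whatever [C] is. *)
pose K := C ^+ k + 1.
have Ck : 0 < C ^+ k by rewrite exprn_gt0.
have K0 : 0 < K by rewrite /K; lra.
pose q := 1 - K^-1.
have [q0 q1] : 0 <= q /\ q < 1.
  have : 0 < K^-1 by rewrite invr_gt0.
  have : K^-1 <= 1 by rewrite invf_le1 // /K; lra.
  by rewrite /q; lra.
have [n qn] : exists n, q ^+ n < alpha by apply: expr_small; rewrite ?q0.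
pose sigma := eta / 2.
have [sigma0 sigma1] : 0 < sigma /\ sigma <= 1 by rewrite /sigma; split; lra.
exists (sigma ^+ n); first by rewrite exprn_gt0.
move=> X mu _ geo [_ [borel_meas _] _ mu_dbl] diam1 mu1 E _ alpha_le.
apply: contrapT => no_ball.
have open_meas (U : set X) : open U -> mu.-caratheodory U.
  by move=> Uo; apply: borel_meas; exact: sub_sigma_algebra.
have dist_le1 (x y : X) : mdist x y <= 1.
  by rewrite -lee_fin -diam1; apply: ereal_sup_ubound; exists (x, y).
have dbl (x : X) r : 0 < r -> fine (mu (cball x (2 * r))) <= C * fine (mu (cball x r)).
  move=> r0; have /fine_le := mu_dbl x r r0.
  by rewrite fineM ?fin_numM ?fin_mu //; apply.
have sparse_ge (x : X) t : sigma ^+ n <= t <= 1 -> E x -> eps <= sparse E x t.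
  move=> tn Ex; rewrite leNgt; apply/negP => lt_eps; apply: no_ball.
  exists x, t; split=> //; exists x; split => //; rewrite /cball /= mdistxx.
  by have := exprn_gt0 n sigma0; lra.
have decay j : (j <= n)%N -> fine (mu (nbhd E (sigma ^+ j))) <= q ^+ j.
  elim: j => [_|j IH jn].
    by rewrite [leRHS]expr0 -[leRHS](m_total mu1); apply: le_m.
  have {}IH := IH (ltnW jn).
  set t := sigma ^+ j in IH.
  have t0 : 0 < t by rewrite exprn_gt0.
  have tn : sigma ^+ n <= t <= 1.
    by rewrite exprn_ile1 ?(ler_wiXn2l _ _ (ltnW jn)) ?(ltW sigma0).
  have eta01 : 0 < eta <= 1 by rewrite eta0.
  have loss : fine (mu (nbhd E t)) <=
      C ^+ k * (fine (mu (nbhd E t)) - fine (mu (nbhd E (sigma * t)))).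
    apply: nbhd_loss k_ge _ => // x Ex.
    by apply: sparse_hole (sparse_ge _ _ tn Ex).
  rewrite !exprS -/t; apply: le_trans (ler_wpM2l q0 IH).
  set a := fine (mu (nbhd E t)) in loss *; set b := fine _ in loss *.
  have ab0 : 0 <= a - b.
    by rewrite -(pmulr_rge0 _ Ck) (le_trans _ loss) // m_ge0.
  have : a / K <= a - b by rewrite ler_pdivrMr // mulrC /K mulrDl mul1r; lra.
  by rewrite /q; lra.
have : alpha <= fine (mu E) by rewrite -lee_fin fineK ?fin_mu.
have sn0 : 0 < sigma ^+ n by rewrite exprn_gt0.
have := le_m mu1 (@sub_nbhd _ _ E _ sn0).
by have := decay n (leqnn n); lra.
Qed.
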